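(* Let $m\ge3$ and let $B_{2m}$ be the biwheel, with rows $a_i$ identified with $i$ and columns $b_j$ identified with $j$ for the Vandermonde weighting. For every edge coloring $\rho$ of $B_{2m}$ and every target $t$, if the exact-$t$ fiber $F=F_{B_{2m},t}$ is nonempty, then $P_F(\lambda)=\sum_{\sigma\in F}\operatorname{sgn}(\sigma)\prod_{i=0}^{m-1}(\lambda+i)^{\sigma(i)}\not\equiv0$.
   Context: The biwheel $B_{2m}$ ($m\ge3$) is the bipartite graph with sides $A=\{a_0,\dots,a_{m-1}\}$, $B=\{b_0,\dots,b_{m-1}\}$ and edges: $(a_0,b_j)$ for all $0\le j\le m-1$; $(a_i,b_0)$ for all $0\le i\le m-1$; and rim edges $(a_i,b_i)$ and $(a_i,b_{i+1})$ for $1\le i\le m-1$, where indices of rim vertices are taken cyclically within $\{1,\dots,m-1\}$ (so $b_m$ means $b_1$). Perfect matchings are bijections $\sigma\colon A\to B$ along edges; with an edge coloring $\rho\colon E\to\{0,1\}$, the exact-$t$ fiber is the set of perfect matchings with $\sum_i\rho(a_i,\sigma(a_i))=t$. *)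

(* Defs.v *)
From mathcomp Require Import all_boot all_order all_fingroup all_algebra.

Set Implicit Arguments.
Unset Strict Implicit.
Unset Printing Implicit Defensive.

Import GRing.Theory.
Local Open Scope ring_scope.

(* Cyclic successor on the rim indices {1, ..., m-1}: m-1 is sent to 1. *)
Definition rim_next (m i : nat) : nat := (if i.+1 == m then 1 else i.+1)%N.

Definition biwheel_edge (m : nat) (i j : 'I_m) : bool :=
  [|| (i == 0 :> nat)%N, (j == 0 :> nat)%N
    | (0 < i)%N && ((j == i :> nat) || (j == rim_next m i :> nat))].

(* The bijection a_i |-> b_(s i) is encoded as the permutation s of 'I_m. *)
Definition biwheel_pm (m : nat) (s : {perm 'I_m}) : bool :=
  [forall i, biwheel_edge i (s i)].

(* An edge coloring is a function on all pairs (i, j); since only perfect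
   matchings are summed over, its values off the edges are never used. *)
Definition exact_fiber (m : nat) (rho : 'I_m -> 'I_m -> bool) (t : nat) :
    {set {perm 'I_m}} :=
  [set s | biwheel_pm s && ((\sum_(i < m) (rho i (s i) : nat))%N == t)].

Definition vdm_poly (m : nat) (F : {set {perm 'I_m}}) : {poly int} :=
  \sum_(s in F)
    (-1) ^+ odd_perm s * \prod_(i < m) ('X + (i%:R)%:P) ^+ s i.

(* Main.v *)
(** The nonvanishing holds for every nonempty set F of perfect matchings, not
    only for fibers.  A matching is determined by j = s(0) and i = s^-1(0), up
    to the choice between the two rim matchings when i = j = 0.  Let j be the
    least value of s(0) on F.

    If some s in F has s(0) = j and i = s^-1(0) < j, evaluate at -i: only the
    matchings with s(i) = 0 survive, all of them have i < s(0), and increasing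
    s(0) from k to k + 1 multiplies the term by i / (k - i) > 0, so all terms
    have the same sign.

    Otherwise consider the coefficient of X^j, to which s in F with s(0) = j
    contributes the product of the k^s(k) up to sign.  If j > 0, then i >= j for
    all of them, and replacing i by i + 1 multiplies the absolute value by
    (i / (i + 1))^(i + 1) <= 1/2.  If j = 0, only the two rim matchings can
    occur, and the identity weighs at least twice the cyclic shift.  In both
    cases the largest term dominates the sum of the others. *)
Require Import Defs.
From mathcomp Require Import all_boot all_order all_fingroup all_algebra.
From mathcomp Require Import zify ring.

Set Implicit Arguments.
Unset Strict Implicit.
Unset Printing Implicit Defensive.

Import Order.TTheory GRing.Theory Num.Theory.
Local Open Scope ring_scope.

(** * Rim rows and the uniqueness of matchings *)

Lemma rim_next_inj (n k l : nat) : (0 < k <= n)%N -> (0 < l <= n)%N ->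
  rim_next n.+1 k = rim_next n.+1 l -> k = l.
Proof.
rewrite /rim_next => hk hl.
by case: eqP; case: eqP; lia.
Qed.

(** From any [k], climb to [n], wrap around to 1 and climb again. *)
Lemma rim_ind (n : nat) (P : nat -> Prop) (k : nat) :
  (forall l, (0 < l <= n)%N -> P l -> P (rim_next n.+1 l)) ->
  (0 < k <= n)%N -> P k -> forall l, (0 < l <= n)%N -> P l.
Proof.
move=> step hk Pk.
have up a d : (0 < a)%N -> (a + d <= n)%N -> P a -> P (a + d)%N.
  move=> a0; elim: d => [|d IH] had Pa; first by rewrite addn0.
  have := step (a + d)%N; rewrite /rim_next ifF; last by apply/eqP; lia.
  by rewrite addnS; apply; [lia | apply: IH => //; lia].
have Pn : P n.
  by have -> : n = (k + (n - k))%N by [lia]; apply: up => //; lia.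
have P1 : P 1%N.
  by have := step n; rewrite /rim_next eqxx; apply => //; lia.
move=> l hl; have -> : l = (1 + (l - 1))%N by lia.
by apply: up => //; lia.
Qed.

Lemma pm_rim (n : nat) (s : {perm 'I_n.+1}) (k : 'I_n.+1) :
  biwheel_pm s -> (0 < k)%N -> (0 < s k)%N ->
  s k = k :> nat \/ s k = rim_next n.+1 k :> nat.
Proof.
move=> /forallP /(_ k); rewrite /biwheel_edge => + k0 sk0.
case/or3P => [/eqP|/eqP|/andP[_ /orP[] /eqP]]; [lia | lia | by left | by right].
Qed.

(* As [s] fixes [k], only [next k] itself can be sent to [next k] by [s], whereas
   [t] already takes the value [next k] at [k] and must move [next k]: the
   disagreement travels around the whole rim. *)
Lemma pm_disagree_rim (n : nat) (s t : {perm 'I_n.+1}) (i k : 'I_n.+1) :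
  (1 < n)%N -> biwheel_pm s -> biwheel_pm t ->
  s ord0 = t ord0 -> s i = ord0 -> t i = ord0 -> (0 < k)%N ->
  s k = k :> nat -> t k = rim_next n.+1 k :> nat ->
  forall l : 'I_n.+1, (0 < l)%N ->
    s l = l :> nat /\ t l = rim_next n.+1 l :> nat.
Proof.
move=> n1 ps pt e0 si ti k0 sk tk l l0.
pose Q (a : nat) := forall b : 'I_n.+1, b = a :> nat ->
  s b = a :> nat /\ t b = rim_next n.+1 a :> nat.
suff : Q l by apply.
apply: (@rim_ind n Q k).
- move=> a ha Qa.
  have ha' : (a < n.+1)%N by lia.
  have [sa ta] := Qa (Ordinal ha') erefl.
  have nx : (0 < rim_next n.+1 a <= n)%N /\ rim_next n.+1 a <> a.
    by rewrite /rim_next; case: eqP; lia.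
  move=> b hb.
  have [p sp] : exists p, s p = b by exists (s^-1%g b); rewrite permKV.
  have pn0 : (0 < p)%N.
    rewrite lt0n; apply/eqP => p0.
    have p0' : p = ord0 by apply: val_inj.
    have : t p = t (Ordinal ha').
      by rewrite p0' -e0 -p0' sp; apply: val_inj; rewrite /= ta hb.
    by move/perm_inj => ep; move: p0; rewrite ep /=; lia.
  have sb : s b = b.
    have := pm_rim ps pn0; rewrite sp; case; first lia.
    - by move=> e; rewrite {1}(_ : b = p) //; apply: val_inj.
    - rewrite hb => e; have hp := ltn_ord p.
      have ep := @rim_next_inj n a p ha (ltac:(lia)) e.
      move: (congr1 val sp); rewrite /= (_ : p = Ordinal ha'); last first.
        by apply: val_inj; rewrite /= ep.
      by rewrite sa hb; lia.
  split; first by rewrite sb.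
  rewrite -{1}hb; case: (@pm_rim n t b pt); rewrite ?hb //; first lia.
  + rewrite lt0n; apply/eqP => tb0.
    have : t b = t i by rewrite ti; apply: val_inj.
    move/perm_inj => bi; move: sb; rewrite bi si => /(congr1 val) /=.
    by rewrite -bi hb; lia.
  + rewrite -hb => /val_inj tb.
    have : t b = t (Ordinal ha').
      by rewrite tb; apply: val_inj; rewrite /= ta hb.
    by move/perm_inj/(congr1 val) => /=; lia.
- by have := ltn_ord k; lia.
- by move=> b /val_inj ->.
- by have := ltn_ord l; lia.
Qed.

(** A row [k] where the two differ is neither 0 nor [i], so both values are nonzero: one is [k], the
    other [rim_next n.+1 k]. This single disagreement spreads over the whole rim. *)
Lemma pm_neq_rim (n : nat) (s t : {perm 'I_n.+1}) (i : 'I_n.+1) :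
  (1 < n)%N -> biwheel_pm s -> biwheel_pm t ->
  s ord0 = t ord0 -> s i = ord0 -> t i = ord0 -> s <> t ->
  (forall l : 'I_n.+1, (0 < l)%N ->
     s l = l :> nat /\ t l = rim_next n.+1 l :> nat) \/
  (forall l : 'I_n.+1, (0 < l)%N ->
     t l = l :> nat /\ s l = rim_next n.+1 l :> nat).
Proof.
move=> n1 ps pt e0 si ti st.
have /existsP [k neq] : [exists k, s k != t k].
  apply: contra_notT st => /existsPn h; apply/permP => k; apply/eqP.
  by have := h k; rewrite negbK.
have k0 : (0 < k)%N.
  rewrite lt0n; apply: contra_neqN neq => /eqP kk.
  by rewrite (_ : k = ord0) //; apply: val_inj.
have pos (r : {perm 'I_n.+1}) : r i = ord0 -> k != i -> (0 < r k)%N.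
  move=> ri; rewrite lt0n; apply: contra => /eqP rk; apply/eqP.
  by apply: (@perm_inj _ r); rewrite ri; apply: val_inj.
have ki : k != i by apply: contra_neq neq => ->; rewrite si ti.
have := pm_rim ps k0 (pos s si ki); have := pm_rim pt k0 (pos t ti ki).
case=> tk [] sk.
- by case/eqP: neq; apply: val_inj; rewrite /= tk sk.
- by right; apply: (@pm_disagree_rim n t s i k).
- by left; apply: (@pm_disagree_rim n s t i k).
- by case/eqP: neq; apply: val_inj; rewrite /= tk sk.
Qed.

(** Two distinct matchings would both send row [i] to a rim column, but it goes to column 0. *)
Lemma pm_uniq (n : nat) (s t : {perm 'I_n.+1}) (i : 'I_n.+1) :
  (1 < n)%N -> biwheel_pm s -> biwheel_pm t -> (0 < i)%N ->
  s ord0 = t ord0 -> s i = ord0 -> t i = ord0 -> s = t.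
Proof.
move=> n1 ps pt i0 e0 si ti; apply/eqP; apply: contraT => /eqP st.
case: (pm_neq_rim n1 ps pt e0 si ti st) => /(_ i i0) []; rewrite ?si ?ti /=; lia.
Qed.

(** * Exponent products and the lowest coefficient *)

Definition exp_prod (n : nat) (x : 'I_n -> int) (s : {perm 'I_n}) : int :=
  \prod_(k < n) x k ^+ s k.

(** Cross-multiplied, so that values of [x] may vanish. *)
Lemma exp_prod_tperm (n : nat) (x : 'I_n -> int) (a b : 'I_n) (s : {perm 'I_n}) :
  a != b ->
  exp_prod x (tperm a b * s)%g * (x a ^+ s a * x b ^+ s b) =
  exp_prod x s * (x a ^+ s b * x b ^+ s a).
Proof.
move=> ab; rewrite /exp_prod.
rewrite (bigD1 a) //= (bigD1 b) 1?eq_sym //= !permM tpermL tpermR.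
rewrite [in RHS](bigD1 a) //= [in RHS](bigD1 b) 1?eq_sym //=.
under eq_bigr => k /andP[ka kb] do rewrite permM tpermD 1?eq_sym //.
ring.
Qed.

Lemma horner_vdm_poly (n : nat) (F : {set {perm 'I_n}}) (x : int) :
  (vdm_poly F).[x] =
  \sum_(s in F) (-1) ^+ odd_perm s * exp_prod (fun k => x + k%:R) s.
Proof.
rewrite horner_sum; apply: eq_bigr => s _.
rewrite hornerM horner_exp hornerN hornerC horner_prod; congr (_ * _).
by apply: eq_bigr => k _; rewrite horner_exp hornerD hornerX hornerC.
Qed.

(* The lowest coefficient of [vdm_poly F]; [maxn k 1] neutralises the factor
   at [k = 0]. *)
Lemma vdm_poly_low (n : nat) (F : {set {perm 'I_n.+1}}) (j : nat) :
  (forall s, s \in F -> (j <= s ord0)%N) ->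
  \sum_(s in F | s ord0 == j :> nat)
    (-1) ^+ odd_perm s * exp_prod (fun k => (maxn k 1)%:R) s != 0 ->
  vdm_poly F != 0.
Proof.
move=> hj; apply: contra => /eqP F0.
(* Row 0 contributes ['X ^+ s ord0], hence ['X^j] splits off; at 0 the cofactor [Q] keeps only the
   [s] with [s ord0 = j]. *)
pose Q : {poly int} := \sum_(s in F) (-1) ^+ odd_perm s *
  ('X^(s ord0 - j) * \prod_(k < n.+1 | k != ord0) ('X + (k%:R)%:P) ^+ s k).
have FQ : vdm_poly F = 'X^j * Q.
  rewrite /vdm_poly /Q big_distrr /=; apply: eq_bigr => s sF.
  rewrite (bigD1 ord0) //= addr0 -{1}(subnKC (hj s sF)) exprD.
  by rewrite -mulrA [RHS]mulrCA.
have {FQ}/eqP : 'X^j * Q = 0 by rewrite -FQ.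
rewrite mulf_eq0 expf_eq0 polyX_eq0 andbF /= => /eqP Q0.
have : Q.[0] = 0 by rewrite Q0 horner0.
rewrite horner_sum => Qh; apply/eqP; rewrite -[RHS]Qh.
rewrite big_mkcondr /=; apply: eq_bigr => s sF.
rewrite !hornerM horner_exp hornerN hornerC horner_exp hornerX horner_prod.
rewrite expr0n subn_eq0 eqn_leq (hj s sF) andbT.
case: ifP => // _; last by rewrite mul0r mulr0.
rewrite mul1r /exp_prod (bigD1 ord0) //= max0n expr1n mul1r.
congr (_ * _); apply: eq_bigr => k k0.
rewrite horner_exp hornerD hornerX hornerC add0r; congr (_%:R ^+ _).
by apply/maxn_idPl; rewrite lt0n.
Qed.

(** * Signed sums with a dominant term *)

Lemma sum_pow2_lt (N : nat) : (\sum_(0 <= k < N) 2 ^ k < 2 ^ N)%N.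
Proof.
elim: N => [|N IH]; first by rewrite big_nil.
by rewrite big_nat_recr //= expnS; lia.
Qed.

(** The term of least level [f] exceeds the sum of the absolute values of the others, since these
    lie on distinct higher levels and lose a factor 2 per level. *)
Lemma signed_sum_neq0 (T : finType) (G : {set T}) (e : T -> bool)
    (a : T -> int) (f : T -> nat) :
  G != set0 -> (forall s, s \in G -> 0 < a s) -> {in G &, injective f} ->
  (forall s t, s \in G -> t \in G -> (f s < f t)%N ->
     a t * 2 ^+ (f t - f s) <= a s) ->
  \sum_(s in G) (-1) ^+ e s * a s != 0.
Proof.
case/set0Pn => r0 r0G apos finj dec.
have [r rG rmin] := arg_minnP f r0G.
rewrite (bigD1 r) //= addr_eq0; apply/negP => /eqP E.
pose N := \max_(s in G) f s.
have fN s : s \in G -> (f s <= N)%N by exact: leq_bigmax_cond.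
have lt s : s \in G -> s != r -> (f r < f s)%N.
  move=> sG sr; rewrite ltn_neqAle rmin // andbT; apply: contra_neq sr => /esym.
  exact: finj.
have ler : a r <= \sum_(s in G | s != r) a s.
  have -> : a r = `|(-1) ^+ e r * a r| by rewrite normrMsign gtr0_norm ?apos.
  rewrite E normrN; apply: le_trans (ler_norm_sum _ _ _) _.
  by apply: ler_sum => s /andP[sG _]; rewrite normrMsign gtr0_norm ?apos.
(* Scaling by a power of 2 clears the denominators of the geometric series. *)
have {}ler : a r * 2 ^+ (N - f r) <= a r * (\sum_(s in G | s != r) 2 ^ (N - f s))%N%:R.
  apply: le_trans (ler_wpM2r _ ler) _; first exact: exprn_ge0.
  rewrite natr_sum big_distrl big_distrr /=; apply: ler_sum => s /andP[sG sr].
  have -> : (N - f r = (f s - f r) + (N - f s))%N by have := fN s sG; have := lt s sG sr; lia.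
  rewrite exprD mulrA natrX; apply: ler_wpM2r; first exact: exprn_ge0.
  exact/dec/lt.
move: ler; rewrite ler_pM2l ?apos // -natrX ler_nat leqNgt => /negP; apply.
apply: leq_ltn_trans (sum_pow2_lt (N - f r)).
(* The exponents [N - f s] are distinct and below [N - f r], so this is part of the full sum of
   powers of 2. *)
rewrite -big_set /= -big_enum -(big_map (fun s => N - f s)%N xpredT (expn 2)).
apply: (@uniq_sub_le_big _ _ leq leqnn (fun x y => leq_addr y x)).
- rewrite map_inj_in_uniq ?enum_uniq // => s t; rewrite !mem_enum !inE.
  move=> /andP[sG _] /andP[tG _] est; apply: finj => //.
  by have := fN s sG; have := fN t tG; lia.
- exact: iota_uniq.
- move=> k /mapP[s]; rewrite mem_enum inE => /andP[sG sr] ->.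
  by rewrite mem_index_iota /=; have := fN s sG; have := lt s sG sr; lia.
Qed.

(** * Signs of the terms at the point [- i] *)

Definition row_term (n : nat) (i : 'I_n) (s : {perm 'I_n}) : int :=
  (-1) ^+ odd_perm s * exp_prod (fun k => - i%:R + k%:R) s.

(** The factor of row [i] is [0 ^+ s i], which is 1 or 0; the other bases [k - i] are nonzero. *)
Lemma row_term_neq0 (n : nat) (i : 'I_n.+1) (s : {perm 'I_n.+1}) :
  (row_term i s != 0) = (s i == ord0).
Proof.
rewrite /row_term mulf_eq0 signr_eq0 /=.
apply/prodf_neq0/eqP => [/(_ i isT)|si k _].
  by rewrite addNr expr0n pnatr_eq0 eqb0 negbK => /eqP e; apply: val_inj.
rewrite expf_eq0 negb_and; have [->|ki] := eqVneq k i; first by rewrite si.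
apply/orP; right; rewrite addrC subr_eq0 eqr_nat; apply: contra ki => /eqP e.
by apply/eqP/val_inj.
Qed.

(** With [j = s ord0], the values [j] and [j.+1] of rows 0 and [j] are swapped. This trades a factor
    [j - i] for [- i], and the sign of the transposition makes the ratio positive. *)
Lemma pm_row_step (n : nat) (i : 'I_n.+1) (s : {perm 'I_n.+1}) :
  (1 < n)%N -> biwheel_pm s -> s i = ord0 -> (i < s ord0 < n)%N ->
  exists s' : {perm 'I_n.+1}, [/\ biwheel_pm s', s' i = ord0,
    s' ord0 = (s ord0).+1 :> nat &
    row_term i s' * (s ord0 - i)%:R = row_term i s * i%:R].
Proof.
move=> n1 ps si /andP[ij jn]; set j := s ord0 in ij jn *.
have i0 : i != ord0 by apply: contraTneq ij => e; rewrite /j -e si.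
have j0 : ord0 != j by apply: contraTneq ij => <-.
have ji : j != i by apply: contraTneq ij => ->; rewrite ltnn.
(* Column [j] is taken by row 0, so row [j] must use its other rim edge; [j < n] excludes the
   wrap. *)
have sj : s j = j.+1 :> nat.
  case: (@pm_rim n s j ps); first by lia.
  - rewrite lt0n; apply: contra_neqN ji => /eqP e.
    by apply: (@perm_inj _ s); rewrite si; apply: val_inj.
  - move=> e; have : s j = s ord0 by apply: val_inj.
    by move/perm_inj => e'; move: j0; rewrite e' eqxx.
  - by rewrite /rim_next ifF //; apply/eqP; lia.
exists (tperm ord0 j * s)%g; split.
- apply/forallP => k; rewrite permM; case: tpermP => [->|->|_ _] //.
  + by rewrite -/j /biwheel_edge eqxx /= (leq_ltn_trans _ ij) // !orbT.
  + exact: (forallP ps).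
- by rewrite permM tpermD // eq_sym.
- by rewrite permM tpermL.
- have := exp_prod_tperm (fun k : 'I_n.+1 => - i%:R + k%:R) s j0.
  rewrite /= -/j sj addr0.
  have -> : - i%:R + j%:R = (j - i)%:R :> int by rewrite natrB 1?addrC // ltnW.
  have x0 : (- i%:R)^+ j * (j - i)%:R ^+ j != 0 :> int.
    by rewrite mulf_neq0 // expf_neq0 // ?oppr_eq0 pnatr_eq0; [exact: i0 | lia].
  move=> E; rewrite /row_term odd_permM odd_tperm j0 signr_addb expr1.
  apply: (mulIf x0); move: E; rewrite /= -/j !exprS.
  move: (exp_prod _ _) (exp_prod _ _) => B A; move: (_ ^+ j) (_ ^+ j) {x0} => v u.
  move: (_ ^+ s) => e E.
  have -> : -1 * e * A * (j - i)%:R * (u * v) = - e * (A * (u * ((j - i)%:R * v))).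
    by ring.
  by rewrite E; ring.
Qed.

(** Row steps raise [s ord0] to [t ord0], where uniqueness identifies the result with [t]. *)
Lemma row_term_same_sign (n : nat) (i : 'I_n.+1) (s t : {perm 'I_n.+1}) :
  (1 < n)%N -> biwheel_pm s -> biwheel_pm t -> s i = ord0 -> t i = ord0 ->
  (i < s ord0 <= t ord0)%N -> 0 < row_term i s * row_term i t.
Proof.
move=> n1 ps pt si ti; move: {2}(t ord0 - s ord0)%N (erefl (t ord0 - s ord0)%N) => d.
elim: d s ps si => [|d IH] s ps si hd /andP[ij jt].
  have st : s ord0 = t ord0 by apply: val_inj => /=; lia.
  have i0 : (0 < i)%N.
    rewrite lt0n; apply: contraTneq ij => e; rewrite -leqNgt.
    by rewrite (_ : ord0 = i) ?si //; apply: val_inj.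
  rewrite (pm_uniq n1 ps pt i0 st si ti) -expr2 lt0r sqr_ge0 andbT.
  by rewrite expf_neq0 // row_term_neq0 ti.
have tn := ltn_ord (t ord0).
have [|s' [ps' si' s0' E]] := @pm_row_step n i s n1 ps si; first lia.
have pos : 0 < row_term i s' * row_term i t by apply: IH => //; lia.
have i0 : 0 < i%:R :> int.
  rewrite ltr0n lt0n; apply: contraTneq ij => e; rewrite -leqNgt.
  by rewrite (_ : ord0 = i) ?si //; apply: val_inj.
have d0 : 0 < (s ord0 - i)%:R :> int by rewrite ltr0n; lia.
rewrite -(pmulr_lgt0 _ i0) mulrAC -E mulrAC.
by rewrite pmulr_lgt0.
Qed.

(** * Decay of the terms in the lowest coefficient *)

(** For positive [i] this is [(1 + 1/i) ^ (i + 1) >= 2], from Bernoulli's inequality. *)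
Lemma double_expn_le (i : nat) : (2 * i ^ i.+1 <= i.+1 ^ i.+1)%N.
Proof.
have bernoulli p : (i ^ p.+1 + p.+1 * i ^ p <= i.+1 ^ p.+1)%N.
  elim: p => [|p IH]; first by rewrite !expn1 expn0; lia.
  rewrite [(i.+1 ^ _)%N]expnS; apply: leq_trans (leq_mul (leqnn i.+1) IH).
  by rewrite [(i ^ p.+2)%N]expnS ![(i ^ p.+1)%N]expnS; nia.
by apply: leq_trans (bernoulli i); rewrite expnS; lia.
Qed.

(** Swapping the values 0 and [i.+1] of rows [i] and [i.+1] replaces [i.+1 ^ i.+1] by [i ^ i.+1]. *)
Lemma pm_col_step (n : nat) (i i' : 'I_n.+1) (s : {perm 'I_n.+1}) :
  biwheel_pm s -> s i = ord0 -> (0 < s ord0 <= i)%N -> i' = i.+1 :> nat ->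
  exists s' : {perm 'I_n.+1}, [/\ biwheel_pm s', s' i' = ord0,
    s' ord0 = s ord0 &
    exp_prod (fun k => (maxn k 1)%:R) s' * 2 <=
    exp_prod (fun k => (maxn k 1)%:R) s].
Proof.
move=> ps si /andP[j0 ji] ii'.
have ii : i != i' by apply/eqP => e; move: ii'; rewrite -e; lia.
(* The row sent to column [i'] is not 0, as [s ord0 <= i], nor [i], which goes to column 0; only
   [i'] is left. *)
have si' : s i' = i'.
  have [p sp] : exists p, s p = i' by exists (s^-1%g i'); rewrite permKV.
  have pi : p != i by apply/eqP => e; move: ii'; rewrite -sp e si.
  have p0 : (0 < p)%N.
    rewrite lt0n; apply/eqP => e; have e' : p = ord0 by apply: val_inj.
    by move: sp ji; rewrite e' => ->; lia.
  case: (@pm_rim n s p ps p0); rewrite sp; first by lia.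
  + by move/val_inj => {1}->.
  + rewrite ii' /rim_next; case: eqP => e; first by lia.
    by case=> e'; case/eqP: pi; apply: val_inj.
exists (tperm i i' * s)%g; split.
- apply/forallP => k; rewrite permM; case: tpermP => [->|->|_ _] //.
  + rewrite si' /biwheel_edge; apply/or3P; apply: Or33; rewrite ii' /rim_next.
    rewrite ifF ?eqxx ?orbT ?andbT; first lia.
    by apply/eqP; have := ltn_ord i'; lia.
  + by rewrite si /biwheel_edge eqxx orbT.
  + exact: (forallP ps).
- by rewrite permM tpermR.
- by rewrite permM tpermD // -val_eqE /=; apply/eqP; lia.
- have := exp_prod_tperm (fun k : 'I_n.+1 => (maxn k 1)%:R) s ii.
  rewrite /= si si' ii' expr0 mul1r mulr1 (maxn_idPl _) // (maxn_idPl _); last by lia.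
  set A := exp_prod _ _; set B := exp_prod _ _ => E.
  have i0 : 0 < i%:R ^+ i.+1 :> int by rewrite exprn_gt0 // ltr0n; lia.
  have A0 : 0 <= A by apply: prodr_ge0 => k _; apply: exprn_ge0.
  rewrite -(ler_pM2r i0) -E -mulrA ler_wpM2l //.
  by rewrite -!natrX -natrM ler_nat double_expn_le.
Qed.

Lemma fact_double_le (p : nat) : (0 < p)%N -> (2 * p`! <= p.+1 ^ p)%N.
Proof.
elim: p => // [[|p] IH] _ //.
have {}IH := IH isT.
rewrite factS mulnCA expnS; apply: leq_mul => //.
by apply: leq_trans IH _; rewrite leq_exp2r.
Qed.

(** The shift turns [k ^ k] into [k ^ k.+1] for [k < n] and [n ^ n] into [n], so the ratio is
    [(n-1)! / n ^ (n-1)], at most 1/2. *)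
Lemma exp_prod_shift_le (n : nat) (s t : {perm 'I_n.+1}) :
  (1 < n)%N ->
  (forall l : 'I_n.+1, (0 < l)%N ->
     s l = l :> nat /\ t l = rim_next n.+1 l :> nat) ->
  exp_prod (fun k => (maxn k 1)%:R) t * 2 <=
  exp_prod (fun k => (maxn k 1)%:R) s.
Proof.
move=> n1 st.
have nat_prod (r : {perm 'I_n.+1}) : exp_prod (fun k => (maxn k 1)%:R) r =
    (\prod_(k < n) k.+1 ^ r (lift ord0 k))%N%:R.
  rewrite natr_prod /exp_prod big_ord_recl max0n expr1n mul1r.
  by apply: eq_bigr => k _; rewrite natrX lift0 (maxn_idPl _).
rewrite !nat_prod -natrM ler_nat.
under eq_bigr => k _ do rewrite (st (lift ord0 k) isT).2 lift0.
under [X in (_ <= X)%N]eq_bigr => k _ do rewrite (st (lift ord0 k) isT).1 lift0.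
case: n n1 {s t st nat_prod} => // p p0.
rewrite !big_ord_recr /= /rim_next eqxx expn1.
rewrite (eq_bigr (fun k : 'I_p => k.+1 * k.+1 ^ k.+1)%N); last first.
  by move=> k _; rewrite ifF ?expnS //; apply/eqP; have := ltn_ord k; lia.
rewrite big_split /=.
have -> : (\prod_(i < p) i.+1 = p`!)%N by rewrite fact_prod big_add1 big_mkord.
rewrite -!mulnA mulnCA leq_mul2l; apply/orP; right.
rewrite mulnCA [(p.+1 ^ _)%N]expnS leq_mul2l; apply/orP; right.
by rewrite mulnC; apply: fact_double_le.
Qed.

(** Column steps move the row of column 0 from [i] to [i'], where uniqueness yields [t]. *)
Lemma pm_col_decay (n : nat) (i i' : 'I_n.+1) (s t : {perm 'I_n.+1}) :
  (1 < n)%N -> biwheel_pm s -> biwheel_pm t -> s i = ord0 -> t i' = ord0 ->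
  s ord0 = t ord0 -> (0 < s ord0 <= i)%N -> (i <= i')%N ->
  exp_prod (fun k => (maxn k 1)%:R) t * 2 ^+ (i' - i) <=
  exp_prod (fun k => (maxn k 1)%:R) s.
Proof.
move=> n1 ps pt si ti'; move: {2}(i' - i)%N (erefl (i' - i)%N) => d.
elim: d i s ps si => [|d IH] i s ps si hd st hj ii.
  have e : i = i' by apply: val_inj => /=; lia.
  rewrite hd mulr1 (pm_uniq n1 ps pt _ st si) ?e //; lia.
have hi : (i.+1 < n.+1)%N by have := ltn_ord i'; lia.
have [s' [ps' si' s0' le2]] := @pm_col_step n i (Ordinal hi) s ps si hj erefl.
apply: le_trans le2; rewrite hd exprSr mulrA ler_pM2r //.
have := IH (Ordinal hi) s' ps' si'; rewrite s0' /= => /(_ (ltac:(lia)) st).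
by have -> : (i' - i.+1 = d)%N; [lia | apply; lia].
Qed.

Theorem theorem5p4 (m : nat) (hm : (3 <= m)%N)
    (rho : 'I_m -> 'I_m -> bool) (t : nat) :
  exact_fiber rho t != set0 -> vdm_poly (exact_fiber rho t) != 0.
Proof.
have : {in exact_fiber rho t, forall s, biwheel_pm s}.
  by move=> s; rewrite inE => /andP[].
move: (exact_fiber rho t) => F {rho t}.
case: m hm F => // n n1 F pmF /set0Pn[r0 r0F].
have {}n1 : (1 < n)%N by [].
have [r rF rmin] := arg_minnP (fun s : {perm 'I_n.+1} => s ord0 : nat) r0F.
set j := r ord0 in rmin.
have zinv (s : {perm 'I_n.+1}) : s (s^-1%g ord0) = ord0 by rewrite permKV.
have [/existsP[s0 /and3P[s0F /eqP s0j s0i]]|] :=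
  boolP [exists s in F, (s ord0 == j) && ((s^-1)%g ord0 < j)%N].
- set i := (s0^-1)%g ord0 in s0i.
  apply/eqP => F0.
  (* Multiplication by the term of [s0] makes every summand nonnegative and that of [s0] positive,
     whatever the common sign. *)
  have : row_term i s0 * (vdm_poly F).[- i%:R] = 0 by rewrite F0 horner0 mulr0.
  apply/eqP; rewrite gt_eqF //.
  rewrite horner_vdm_poly big_distrr (bigD1 s0) //= ltr_pwDl //.
    by apply: row_term_same_sign; rewrite ?zinv ?pmF // s0j s0i /=.
  apply: sumr_ge0 => s /andP[sF _]; rewrite -/(row_term i s).
  have [si|si] := eqVneq (s i) ord0; last first.
    have := row_term_neq0 i s; rewrite (negbTE si) => /negbFE /eqP ->.
    by rewrite mulr0.
  apply/ltW/row_term_same_sign; rewrite ?zinv ?pmF // s0j s0i /=.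
  exact: rmin.
- move=> /existsPn hF; apply: (@vdm_poly_low n F j) => //.
  rewrite -big_set /=; set G := [set s | _].
  have GP s : s \in G -> [/\ s \in F, biwheel_pm s & s ord0 = j].
    by rewrite inE => /andP[sF /eqP /val_inj e]; rewrite sF pmF.
  have G0 : G != set0 by apply/set0Pn; exists r; rewrite inE eqxx andbT.
  have apos (s : {perm 'I_n.+1}) : 0 < exp_prod (fun k => (maxn k 1)%:R) s.
    by apply: prodr_gt0 => k _; rewrite exprn_gt0 // ltr0n leq_max orbT.
  have [j0|j0] := posnP j.
  + have o1 : (1 < n.+1)%N by lia.
    have jE : j = ord0 by apply: val_inj.
    (* Row 0 is matched to column 0 here, so distinct elements of [G] are the identity and the shift
       on the rim. *)
    have n2 s u : s \in G -> u \in G -> s <> u -> _ :=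
      fun sG uG => let: And3 _ ps es := GP s sG in let: And3 _ pu eu := GP u uG in
        pm_neq_rim n1 ps pu (etrans es (esym eu)) (etrans es jE) (etrans eu jE).
    (* Row 1 tells the two apart: level 0 for the identity, level 1 for the shift. *)
    pose f (s : {perm 'I_n.+1}) : nat := (s (Ordinal o1) != 1 :> nat)%N.
    have nx : rim_next n.+1 1 != 1%N.
      by rewrite /rim_next ifF //; apply/eqP; lia.
    apply: (@signed_sum_neq0 _ G _ _ f) => //.
    * move=> s u sG uG fsu; apply/eqP; apply: contraT => /eqP su.
      move: fsu; rewrite /f.
      by case: (n2 s u sG uG su) => /(_ (Ordinal o1) isT) [-> ->]; rewrite (negbTE nx).
    * move=> s u sG uG; rewrite /f.
      have su : (f s < f u)%N -> s <> u by move=> + e; rewrite e ltnn.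
      move=> lt; have := n2 s u sG uG (su lt); case => h.
        have [-> ->] := h (Ordinal o1) isT; rewrite eqxx nx /= expr1.
        exact: exp_prod_shift_le.
      by move: lt; have [-> ->] := h (Ordinal o1) isT; rewrite eqxx nx.
  (* For [j > 0] the level of a matching is the row sent to column 0. *)
  + apply: (@signed_sum_neq0 _ G _ _ (fun s => (s^-1)%g ord0)) => //.
    * move=> s u sG uG /val_inj e.
      have [_ ps es] := GP s sG; have [_ pu eu] := GP u uG.
      apply: (pm_uniq (i := (s^-1)%g ord0)) => //.
      - rewrite lt0n; apply: contraTneq j0 => i0.
        by rewrite -es (_ : ord0 = (s^-1)%g ord0) ?zinv //; apply: val_inj.
      - by rewrite es eu.
      - by rewrite e.
    * move=> s u sG uG lt.
      have [sF ps es] := GP s sG; have [_ pu eu] := GP u uG.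
      apply: pm_col_decay; rewrite ?zinv //; last exact: ltnW.
        by rewrite es eu.
      (* The failure of the first case gives [j <= i] for every matching in [G]. *)
      by have := hF s; rewrite sF es eqxx /= -leqNgt j0.
Qed.
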